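(* Let $x:M^2\to\mathbb{C}^2$ be an immersed surface with constant Kähler angle $\theta$. Let $H$ be its mean curvature vector, $\mathbf{J}$ the canonical complex structure of $\mathbb{C}^2$ and $\beta_x$ the Lagrangian angle of $x$. Then $$\sin^2\theta\; x_*(\nabla\beta_x)=-(\mathbf{J}H)^\top,$$ where $^\top$ denotes the orthogonal projection onto the tangent space $x_*(TM^2)$ and $\nabla$ is the gradient on $M^2$ with respect to the induced metric.
   Context: $\mathbb{C}^2$ has coordinates $z_k=x_k+\sqrt{-1}\,y_k$ ($k=1,2$), the Euclidean metric $\langle\cdot,\cdot\rangle$, the canonical complex structure $\mathbf{J}\frac{\partial}{\partial x_k}=\frac{\partial}{\partial y_k}$, $\mathbf{J}\frac{\partial}{\partial y_k}=-\frac{\partial}{\partial x_k}$, and the Kähler form $\omega$ determined by $\langle U,V\rangle=\omega(U,\mathbf{J}V)$. Let $x:M^2\to\mathbb{C}^2$ be a smooth immersion of an oriented surface, with induced metric and volume form $dV_M$. The Kähler angle $\theta:M\to[0,\pi]$ of $x$ is defined by $x^*\omega=\cos\theta\, dV_M$; equivalently $\cos\theta=\langle\mathbf{J}(x_*e_1),x_*e_2\rangle$ for any oriented orthonormal tangent frame $\{e_1,e_2\}$. Let $\Omega=dz_1\wedge dz_2$. There is a complex-valued function $\eta_x$ on $M$ with $x^*\Omega=\eta_x\, dV_M$, namely $\eta_x=\Omega(x_*e_1,x_*e_2)$. When $\eta_x\neq0$ everywhere (which is the case if $\theta\in(0,\pi)$ everywhere), the Lagrangian angle $\beta_x:M\to\mathbb{R}/2\pi\mathbb{Z}$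 is defined by $\eta_x=|\eta_x|e^{\sqrt{-1}\beta_x}$; its differential $d\beta_x$ and its gradient $\nabla\beta_x$ are globally well defined on $M$. When $\sin\theta\equiv 0$ the Lagrangian angle is undefined, and the left-hand side of the formula is understood to be $0$. The mean curvature vector is the trace of the second fundamental form $h$: $H=h(e_1,e_1)+h(e_2,e_2)$. *)

(* Defs.v *)
From HB Require Import structures.
From mathcomp Require Import all_boot all_order all_algebra.
From mathcomp Require Import all_classical all_reals all_analysis.
From mathcomp Require Import complex ring.

Set Implicit Arguments.
Unset Strict Implicit.
Unset Printing Implicit Defensive.

Import Order.TTheory GRing.Theory Num.Theory.
Import numFieldNormedType.Exports.

Local Open Scope classical_set_scope.
Local Open Scope ring_scope.
Local Open Scope complex_scope.

(* C^2 is viewed as the real vector space of rows (x_1, x_2 | y_1, y_2). *)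
Notation C2 R := ('rV[R]_(2 + 2)).

Section Ambient.
Variable R : realType.
Implicit Types U V : C2 R.

Definition dz (k : 'I_2) U : R[i] := lsubmx U 0 k +i* rsubmx U 0 k.

Definition dot U V : R := \sum_k U 0 k * V 0 k.

Definition J U : C2 R := row_mx (- rsubmx U) (lsubmx U).

(* The solution of <U, V> = omega (U, J V), as J^-1 = - J; see omegaJ. *)
Definition omega U V : R := dot U (- J V).

Definition Omega U V : R[i] := dz 0 U * dz 1 V - dz 1 U * dz 0 V.

Lemma dotE U V : dot U V = (U *m V^T) 0 0.
Proof. by rewrite mxE; apply: eq_bigr => k _; rewrite mxE. Qed.

Lemma dotC U V : dot U V = dot V U.
Proof. by apply: eq_bigr => k _; rewrite mulrC. Qed.

Lemma dot_linear U a V W : dot U (a *: V + W) = a * dot U V + dot U W.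
Proof. by rewrite !dotE linearP /= linearP !mxE. Qed.

Lemma dotD U V W : dot U (V + W) = dot U V + dot U W.
Proof. by rewrite !dotE linearD /= mulmxDr mxE. Qed.

Lemma dotZ U a V : dot U (a *: V) = a * dot U V.
Proof. by rewrite !dotE linearZ /= -scalemxAr mxE. Qed.

Lemma dot_eq0 U : dot U U = 0 -> U = 0.
Proof.
move=> /eqP; rewrite psumr_eq0 => [/allP U0|k _]; last by rewrite -expr2 sqr_ge0.
apply/rowP => k; rewrite mxE; have := U0 k (mem_index_enum _).
by rewrite /= mulf_eq0 orbb => /eqP.
Qed.

Lemma JK U : J (J U) = - U.
Proof. by rewrite /J row_mxKl row_mxKr -{3}(hsubmxK U) opp_row_mx. Qed.

Lemma omegaJ U V : dot U V = omega U (J V).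
Proof. by rewrite /omega JK opprK. Qed.

Lemma Omega_comb a b c d U V :
  Omega (a *: U + b *: V) (c *: U + d *: V) = (a * d - b * c)%:C * Omega U V.
Proof.
rewrite /Omega /dz !mxE; simpc; apply/eqP; rewrite eq_complex /=.
by apply/andP; split; apply/eqP; ring.
Qed.

End Ambient.

Section Smooth.
Variables (R : realType) (V W : normedModType R).

(* For finite-dimensional V this is the class C^k: differentiability is in the
   sense of Frechet and 'D_v f is the derivative of f in the direction v. *)
Fixpoint continuously_differentiable (k : nat) (A : set V) (f : V -> W) : Prop :=
  if k is k'.+1 then
    (forall a, A a -> differentiable f a) /\
    (forall v, continuously_differentiable k' A ('D_v f))
  else forall a, A a -> {for a, continuous f}.

Definition smooth_on A f := forall k, continuously_differentiable k A f.

End Smooth.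

(* An oriented smooth surface without boundary, given by an oriented atlas.
   The map [param i] is only meaningful on the image of the chart [i]. *)
Record oriented_surface (R : realType) := OrientedSurface {
  carrier :> topologicalType;
  _ : hausdorff_space carrier;
  _ : @second_countable carrier;
  atlas : Type;
  dom : atlas -> set carrier;
  chart : atlas -> carrier -> 'rV[R]_2;
  param : atlas -> 'rV[R]_2 -> carrier;
  dom_open : forall i, open (dom i);
  dom_cover : forall p, exists i, dom i p;
  chart_open : forall i, open (chart i @` dom i);
  chartK : forall i p, dom i p -> param i (chart i p) = p;
  chart_continuous : forall i p, dom i p -> {for p, continuous (chart i)};
  param_continuous : forall i a, (chart i @` dom i) a ->
    {for a, continuous (param i)};
  transition_smooth : forall i j,
    smooth_on (chart i @` (dom i `&` dom j)) (chart j \o param i);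
  transition_oriented : forall i j a, (chart i @` (dom i `&` dom j)) a ->
    0 < \det ('J (chart j \o param i) a) }.

Arguments dom {R M} i _ : rename.
Arguments chart {R M} i _ : rename.
Arguments param {R M} i _ : rename.

Section Surface.
Variables (R : realType) (M : oriented_surface R).

(* A tangent vector at p is given by its coordinates u : 'rV_2 in a chart i
   around p; [tdiff i p f u] is the differential of f at p applied to it. *)
Definition tdiff (W : normedModType R) (i : atlas M) (p : M) (f : M -> W)
    : 'rV[R]_2 -> W :=
  'd (f \o param i) (chart i p).

Definition smooth_immersion (x : M -> C2 R) :=
  (forall i, smooth_on (chart i @` dom i) (x \o param i)) /\
  (forall i p, dom i p -> injective (tdiff i p x)).

Variables (x : M -> C2 R) (i : atlas M) (p : M).
Implicit Types (u v : 'rV[R]_2) (U : C2 R).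

Definition metric u v : R := dot (tdiff i p x u) (tdiff i p x v).

Definition gram : 'M[R]_2 := \matrix_(j, k) metric 'e_j 'e_k.

(* Takes the value 1 on oriented orthonormal frames; see volume_form_frame. *)
Definition volume_form u v : R :=
  Num.sqrt (\det gram) * \det (col_mx u v : 'M[R]_2).

Definition orthonormal_frame u v :=
  [/\ metric u u = 1, metric v v = 1 & metric u v = 0].

Definition oriented_frame u v := 0 < \det (col_mx u v : 'M[R]_2).

(* Raising the index of a linear form l on the tangent plane; see sharpP. *)
Definition sharp (l : 'rV[R]_2 -> R) : 'rV[R]_2 :=
  (\row_k l 'e_k) *m invmx gram.

(* Orthogonal projections on the tangent plane and on the normal plane; see
   tangentialP. *)
Definition tangential U : C2 R :=
  tdiff i p x (sharp (fun v => dot U (tdiff i p x v))).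

Definition normal U : C2 R := U - tangential U.

(* The ambient derivative of the field v along u, both extended with constant
   coordinates. *)
Definition ambient_derivative u v : C2 R :=
  'D_u ('D_v (x \o param i)) (chart i p).

Definition second_form u v : C2 R := normal (ambient_derivative u v).

(* Trace with respect to the metric; see mean_curvatureE. *)
Definition mean_curvature : C2 R :=
  \sum_j \sum_k (invmx gram) j k *: second_form 'e_j 'e_k.

(* The density of Omega with respect to the volume form; see pullback_Omega
   and etaE. *)
Definition eta : R[i] :=
  Omega (tdiff i p x 'e_0) (tdiff i p x 'e_1) / (volume_form 'e_0 'e_1)%:C.

(* A point of R/2piZ is represented by the set of its real representatives. *)
Definition lagrangian_angle : set R :=
  [set b | eta = `|eta| * (cos b +i* sin b)].

Lemma linear_coord (W : lmodType R) (l : {linear 'rV[R]_2 -> W}) u :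
  l u = \sum_k u 0 k *: l 'e_k.
Proof.
rewrite {1}(row_sum_delta u) linear_sum.
by apply: eq_bigr => k _; rewrite linearZ.
Qed.

Lemma tdiff_sum u : tdiff i p x u = \sum_k u 0 k *: tdiff i p x 'e_k.
Proof. exact: linear_coord. Qed.

Lemma metricE u v : metric u v = (u *m gram *m v^T) 0 0.
Proof.
rewrite -mulmxA mxE /metric [in LHS]tdiff_sum dotC.
rewrite !big_ord_recl !big_ord0 !addr0 dotD !dotZ.
rewrite ![dot (tdiff _ _ _ v) _]dotC [tdiff _ _ _ v]tdiff_sum.
rewrite !big_ord_recl !big_ord0 !addr0 !dotD !dotZ !mxE.
rewrite !big_ord_recl !big_ord0 !addr0 !mxE /metric.
ring.
Qed.

Lemma gram_sym : gram^T = gram.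
Proof. by apply/matrixP => j k; rewrite !mxE /metric dotC. Qed.

Lemma metric_gt0 u : injective (tdiff i p x) -> u != 0 -> 0 < metric u u.
Proof.
move=> inj u0; rewrite lt0r sumr_ge0 ?andbT => [|k _]; last first.
  by rewrite -expr2 sqr_ge0.
apply: contra_neq u0 => /dot_eq0 Xu0; apply: inj.
by rewrite Xu0 [RHS](linear0 ('d _ _)).
Qed.

Lemma gram_unit : injective (tdiff i p x) -> gram \in unitmx.
Proof.
move=> inj; rewrite -row_free_unit -kermx_eq0; apply/eqP/row_matrixP => k.
rewrite row0; set w := row k _; apply/eqP; apply: contraT => /metric_gt0.
move=> /(_ inj); rewrite metricE (_ : w *m gram = 0) ?mul0mx ?mxE ?ltxx//.
by apply/sub_kermxP; exact: row_sub.
Qed.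

Lemma sharpP (l : {linear 'rV[R]_2 -> R}) : injective (tdiff i p x) ->
  forall v, metric (sharp l) v = l v.
Proof.
move=> inj v; rewrite metricE /sharp mulmxKV ?gram_unit// mxE.
rewrite [RHS]linear_coord; apply: eq_bigr => k _.
by rewrite !mxE mulrC.
Qed.

Lemma tangentialP U : injective (tdiff i p x) ->
  range (tdiff i p x) (tangential U) /\
  forall v, dot (U - tangential U) (tdiff i p x v) = 0.
Proof.
move=> inj; split=> [|v]; first by eexists.
pose l v := dot U (tdiff i p x v).
have lP : linear l by move=> a u w; rewrite /l /tdiff linearP dot_linear.
pose lL := GRing.isLinear.Build _ _ _ _ l lP.
pose L : {linear 'rV[R]_2 -> R} := HB.pack l lL.
rewrite dotC dotD -scaleN1r dotZ mulN1r ![dot (tdiff _ _ _ v) _]dotC.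
by rewrite -[X in _ - X]/(metric (sharp L) v) sharpP// subrr.
Qed.

Lemma frame_row u v (k : 'I_2) :
  row k (col_mx u v : 'M[R]_2) = if k == 0 then u else v.
Proof.
case: k => -[|[|//]] k2.
- have -> : Ordinal k2 = lshift 1 (ord0 : 'I_1) by exact: val_inj.
  by apply: etrans (rowKu (ord0 : 'I_1) u v) _; rewrite row_id.
- have -> : Ordinal k2 = rshift 1 (ord0 : 'I_1) by exact: val_inj.
  by apply: etrans (rowKd (ord0 : 'I_1) u v) _; rewrite row_id.
Qed.

Lemma gram_frame u v j k : let E : 'M[R]_2 := col_mx u v in
  (E *m gram *m E^T) j k = metric (row j E) (row k E).
Proof.
move=> E; rewrite metricE -row_mul [LHS]mxE [RHS]mxE.
by apply: eq_bigr => l _; rewrite !mxE.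
Qed.

Lemma frame_inv u v : orthonormal_frame u v ->
  let E : 'M[R]_2 := col_mx u v in E *m gram *m E^T = 1%:M.
Proof.
move=> [uu vv uv] E; apply/matrixP => j k.
rewrite gram_frame !frame_row mxE.
have vu : metric v u = 0 by rewrite -uv /metric dotC.
by case: j k => -[|[|//]] ? [[|[|//]] ?] /=.
Qed.

Lemma volume_form_frame u v : orthonormal_frame u v -> oriented_frame u v ->
  volume_form u v = 1.
Proof.
move=> uv; rewrite /oriented_frame => o.
have := congr1 determinant (frame_inv uv).
rewrite !det_mulmx det_tr det1 /volume_form; move: o.
set d : R := \det _ => d0 dE.
have <- : Num.sqrt (d ^+ 2) = d by rewrite sqrtr_sqr gtr0_norm.
by rewrite mulrC -sqrtrM ?sqr_ge0// -[RHS]sqrtr1 -dE; congr Num.sqrt; ring.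
Qed.

Lemma det_frame u v : \det (col_mx u v : 'M[R]_2) = u 0 0 * v 0 1 - u 0 1 * v 0 0.
Proof.
pose B : 'M[R]_2 := col_mx u v; rewrite -[LHS]/(\det B).
have E j k : B j k = if j == 0 then u 0 k else v 0 k.
  have := congr1 (fun w : 'rV[R]_2 => w 0 k) (frame_row u v j).
  by rewrite mxE => ->; case: ifP.
clearbody B; rewrite (expand_det_row _ 0) !big_ord_recl big_ord0 /cofactor !det_mx11 !mxE !E /=.
have -> : lift 0 0 = 1 :> 'I_2 by exact: val_inj.
have -> : lift 1 0 = 0 :> 'I_2 by exact: val_inj.
by rewrite !(expr0, expr1, mul1r) addr0 mulN1r mulrN.
Qed.

Lemma det_gram_gt0 : injective (tdiff i p x) -> 0 < \det gram.
Proof.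
move=> inj; set a := metric 'e_0 'e_0; set b := metric 'e_0 'e_1.
have e00 : 'e_0 != 0 :> 'rV[R]_2.
  by apply/eqP => /rowP/(_ 0); rewrite !mxE /= => /eqP; rewrite oner_eq0.
have a0 : 0 < a by exact: metric_gt0.
pose w : 'rV[R]_2 := a *: 'e_1 - b *: 'e_0.
have w0 : w != 0.
  apply/eqP => /rowP/(_ 1); rewrite !mxE /= mulr1 mulr0 subr0 => /eqP.
  by rewrite gt_eqF.
have := metric_gt0 inj w0.
suff -> : metric w w = a * \det gram by rewrite pmulr_rgt0.
rewrite metricE (expand_det_row _ 0) !mxE !big_ord_recl !big_ord0 !mxE.
rewrite !big_ord_recl !big_ord0 /cofactor !det_mx11 !mxE /=.
have -> : lift ord0 ord0 = 1 :> 'I_2 by exact: val_inj.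
have -> : lift 1 0 = 0 :> 'I_2 by exact: val_inj.
have -> : metric 'e_1 'e_0 = b by rewrite /metric dotC.
rewrite -/a -/b /=; ring.
Qed.

Lemma volume_form_neq0 : injective (tdiff i p x) -> volume_form 'e_0 'e_1 != 0.
Proof.
move=> inj; rewrite /volume_form det_frame !mxE /= mulr1 mulr0 subr0 mulr1.
by rewrite gt_eqF// sqrtr_gt0 det_gram_gt0.
Qed.

Lemma pullback_Omega u v : injective (tdiff i p x) ->
  Omega (tdiff i p x u) (tdiff i p x v) = eta * (volume_form u v)%:C.
Proof.
move=> inj.
have -> : volume_form u v = (u 0 0 * v 0 1 - u 0 1 * v 0 0) * volume_form 'e_0 'e_1.
  by rewrite /volume_form !det_frame !mxE /=; ring.
rewrite rmorphM mulrCA /eta divfK; last first.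
  by rewrite eq_complex /= eqxx andbT volume_form_neq0.
rewrite (tdiff_sum u) (tdiff_sum v) !big_ord_recl !big_ord0 !addr0.
have -> : lift ord0 ord0 = 1 :> 'I_2 by exact: val_inj.
exact: Omega_comb.
Qed.

Lemma etaE u v : injective (tdiff i p x) ->
  orthonormal_frame u v -> oriented_frame u v ->
  eta = Omega (tdiff i p x u) (tdiff i p x v).
Proof.
by move=> inj uv o; rewrite pullback_Omega// volume_form_frame// mulr1.
Qed.

Lemma tangential_sum (I : finType) (c : I -> R) (F : I -> C2 R) :
  tangential (\sum_k c k *: F k) = \sum_k c k *: tangential (F k).
Proof.
have sharpS (l : 'rV[R]_2 -> R) (L : I -> 'rV[R]_2 -> R) :
    (forall v, l v = \sum_k c k * L k v) ->
    sharp l = \sum_k c k *: sharp (L k).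
  move=> lE; under eq_bigr do rewrite /sharp scalemxAl.
  rewrite -mulmx_suml; congr (_ *m _); apply/rowP => j.
  by rewrite mxE lE summxE; apply: eq_bigr => k _; rewrite !mxE.
rewrite /tangential (sharpS _ (fun k v => dot (F k) (tdiff i p x v))).
  by rewrite /tdiff linear_sum; apply: eq_bigr => k _; rewrite linearZ.
move=> v; rewrite dotC dotE linear_sum /= mulmx_sumr summxE.
by apply: eq_bigr => k _; rewrite linearZ /= -scalemxAr mxE -dotE dotC.
Qed.

Lemma ambient_derivative_sum u v : smooth_immersion x -> dom i p ->
  ambient_derivative u v =
    \sum_j \sum_k (u 0 j * v 0 k) *: ambient_derivative 'e_j 'e_k.
Proof.
move=> [sm _] ip; set X := x \o param i; set a := chart i p.
have Aa : (chart i @` dom i) a by exists p.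
have dX b : (chart i @` dom i) b -> differentiable X b by case: (sm i 1) => + _; exact.
have dDX w : differentiable ('D_w X) a by case: (sm i 2) => _ /(_ w)[+ _]; exact.
have DX : \forall b \near a, 'D_v X b = (\sum_k v 0 k *: 'D_('e_k) X) b.
  near=> b; have bA : (chart i @` dom i) b.
    by near: b; apply: open_nbhs_nbhs; split => //; exact: chart_open.
  rewrite deriveE; last exact: dX.
  rewrite linear_coord fct_sumE; apply: eq_bigr => k _.
  by rewrite -deriveE//; exact: dX.
rewrite /ambient_derivative (near_eq_derive u DX) derive_sum => [|k]; last first.
  by apply: derivableZ; exact: diff_derivable.
rewrite exchange_big; apply: eq_bigr => k _ /=.
rewrite deriveZ; last exact: diff_derivable.
rewrite deriveE// linear_coord scaler_sumr; apply: eq_bigr => j _.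
by rewrite deriveE// scalerA mulrC.
Unshelve. all: by end_near. Qed.

Lemma mean_curvatureE u v : smooth_immersion x -> dom i p ->
  orthonormal_frame u v -> mean_curvature = second_form u u + second_form v v.
Proof.
move=> imm ip uv; have inj := imm.2 i p ip.
have second_sum w w' : second_form w w' =
    \sum_j \sum_k (w 0 j * w' 0 k) *: second_form 'e_j 'e_k.
  rewrite {1}/second_form ambient_derivative_sum// !pair_big /=.
  rewrite /normal tangential_sum -sumrB.
  by apply: eq_bigr => k _; rewrite scalerBr.
pose E : 'M[R]_2 := col_mx u v.
have EE : invmx gram = E^T *m E.
  have EG := frame_inv uv; rewrite /= -/E -mulmxA in EG.
  have GE := mulmx1C EG; rewrite -mulmxA in GE.
  by rewrite -[LHS]mulmx1 -GE mulKmx ?gram_unit.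
have Eu k j : E k j = if k == 0 then u 0 j else v 0 j.
  have := congr1 (fun w : 'rV[R]_2 => w 0 j) (frame_row u v k).
  by rewrite mxE => ->; case: ifP.
rewrite (second_sum u) (second_sum v) -big_split; apply: eq_bigr => j _ /=.
rewrite -big_split; apply: eq_bigr => k _ /=; rewrite EE mxE -scalerDl.
by rewrite !big_ord_recl big_ord0 ![E^T _ _]mxE !Eu /= addr0.
Qed.

End Surface.

Section Angles.
Variables (R : realType) (M : oriented_surface R) (x : M -> C2 R).

Definition is_kahler_angle (theta : M -> R) :=
  forall p, 0 <= theta p <= pi /\
    forall i, dom i p -> forall u v,
      omega (tdiff i p x u) (tdiff i p x v) =
        cos (theta p) * volume_form x i p u v.

Variables (i : atlas M) (p : M).

Definition angle_lift (b : M -> R) :=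
  \forall q \near p, {for q, continuous b} /\ lagrangian_angle x i q (b q).

(* The differential of the R/2piZ-valued Lagrangian angle, through a continuous
   real-valued lift near p. *)
Definition angle_differential : 'rV[R]_2 -> R :=
  tdiff i p (xget (cst 0) angle_lift : M -> R).

Definition angle_gradient : 'rV[R]_2 := sharp x i p angle_differential.

End Angles.

(* Main.v *)
Require Import Defs.
From HB Require Import structures.
From mathcomp Require Import all_boot all_order all_algebra.
From mathcomp Require Import all_classical all_reals all_analysis.
From mathcomp Require Import complex ring.

Set Implicit Arguments.
Unset Strict Implicit.
Unset Printing Implicit Defensive.

Import Order.TTheory GRing.Theory Num.Theory.
Import numFieldNormedType.Exports.

Local Open Scope classical_set_scope.
Local Open Scope ring_scope.

(** Let U and V be the coordinate tangent vectors of the immersed surface in a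
chart, g = |U|^2 |V|^2 - <U,V>^2 the square of the area density, and
N = Omega(U,V), so that eta = N / sqrt g has the same argument as N.

Differentiating N = |N| e^(i beta) gives |N|^2 d beta = Im (conj N dN)
(derive_angle, angle_differential_density).  The Lagrange identity
|N|^2 + omega(U,V)^2 = g and the equation omega(U,V) = cos theta sqrt g give
|N|^2 = sin^2 theta g.  So the inner product of the left-hand side of the
formula with the coordinate vector X_k is Im (conj N d_k N) / g: this also holds
when sin theta = 0, because N is then 0.  The inner product of the right-hand
side with X_k is -<J H, X_k> = <H, J X_k>.  Both sides are tangent vectors, and
the theorem amounts to g <H, J X_k> = Im (conj N d_k N), which is
mean_curvature_Omega.

This last identity does not hold for a general surface.  By the polarized
Lagrange identity (Im_conj_Omega) the two members are linear in the second
derivatives of the immersion, with coefficients that are functions of the inner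
products and of omega on U and V.  Their difference is a combination of the
quantities 2 g d_k (omega(U,V)) - omega(U,V) d_k g for k = 0, 1, which vanish
because omega(U,V) is a constant multiple of sqrt g (angle_relation_partials,
Im_conj_Omega_fst, Im_conj_Omega_snd).  In an orthonormal tangent frame
e_1, e_2, with normal vectors e_3 = (J e_1 - cos theta e_2) / sin theta and
e_4 = (J e_2 + cos theta e_1) / sin theta, the vanishing reads
<h(e_1,e_1),e_4> = <h(e_1,e_2),e_3> and <h(e_1,e_2),e_4> = <h(e_2,e_2),e_3>.
The mixed second derivatives have to agree, which is Schwarz's theorem
(derive_commute_mx).

The form d beta is the differential of a continuous real lift of the angle.
Near a point where N = N_0 is not 0, every such lift is its value at the point
plus the arctangent of Im (conj N_0 N) / Re (conj N_0 N) (polar_unique), and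
this formula does define a lift (polar_atan).  Hence lifts exist, and all of
them are differentiable. *)

(** * Hermitian algebra of the plane of complex vectors *)

Section HermitianAlgebra.
Variable R : realType.
Implicit Types U V A B C : C2 R.

Lemma dot_coord U V : dot U V =
  lsubmx U 0 0 * lsubmx V 0 0 + lsubmx U 0 1 * lsubmx V 0 1 +
  (rsubmx U 0 0 * rsubmx V 0 0 + rsubmx U 0 1 * rsubmx V 0 1).
Proof.
rewrite /dot big_split_ord /= !big_ord_recl !big_ord0 !addr0 !mxE.
by have -> : lift ord0 ord0 = 1 :> 'I_2 by exact: val_inj.
Qed.

Lemma omega_coord U V : omega U V =
  lsubmx U 0 0 * rsubmx V 0 0 + lsubmx U 0 1 * rsubmx V 0 1 -
  (rsubmx U 0 0 * lsubmx V 0 0 + rsubmx U 0 1 * lsubmx V 0 1).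
Proof.
rewrite /omega dot_coord /J opp_row_mx row_mxKl row_mxKr !mxE.
ring.
Qed.

Lemma Re_Omega U V : complex.Re (Omega U V) =
  lsubmx U 0 0 * lsubmx V 0 1 - rsubmx U 0 0 * rsubmx V 0 1 -
  (lsubmx U 0 1 * lsubmx V 0 0 - rsubmx U 0 1 * rsubmx V 0 0).
Proof. by rewrite /Omega /dz; simpc. Qed.

Lemma Im_Omega U V : complex.Im (Omega U V) =
  lsubmx U 0 0 * rsubmx V 0 1 + rsubmx U 0 0 * lsubmx V 0 1 -
  (lsubmx U 0 1 * rsubmx V 0 0 + rsubmx U 0 1 * lsubmx V 0 0).
Proof. by rewrite /Omega /dz; simpc. Qed.

Definition sq_area U V : R := dot U U * dot V V - dot U V ^+ 2.

(** The Lagrange identity: |Omega(U,V)|^2 is the Gram determinant of U and V for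
the Hermitian product <U,V> - i omega(U,V). *)
Lemma normsq_Omega U V :
  complex.Re (Omega U V) ^+ 2 + complex.Im (Omega U V) ^+ 2 =
  sq_area U V - omega U V ^+ 2.
Proof.
rewrite Re_Omega Im_Omega /sq_area !dot_coord omega_coord; ring.
Qed.

Definition im_conj_mul (z w : R[i]) : R :=
  complex.Re z * complex.Im w - complex.Im z * complex.Re w.

Lemma im_conj_mulDr z w w' :
  im_conj_mul z (w + w') = im_conj_mul z w + im_conj_mul z w'.
Proof. by case: z w w' => [? ?] [? ?] [? ?]; rewrite /im_conj_mul /=; ring. Qed.

Lemma im_conj_mulNN z w : im_conj_mul (- z) (- w) = im_conj_mul z w.
Proof. by case: z w => [? ?] [? ?]; rewrite /im_conj_mul /=; ring. Qed.

(** Polarized Lagrange identity: with the Hermitian product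
h(A,B) = <A,B> - i omega(A,B), the product conj (Omega(U,V)) Omega(A,V) equals
h(A,U) h(V,V) - h(A,V) h(V,U).  This is the imaginary part. *)
Lemma Im_conj_Omega A U V :
  im_conj_mul (Omega U V) (Omega A V) =
  dot U V * omega A V - dot V V * omega A U - dot A V * omega U V.
Proof.
by rewrite /im_conj_mul !Re_Omega !Im_Omega !dot_coord !omega_coord; ring.
Qed.

Lemma Omega_anti U V : Omega V U = - Omega U V.
Proof. by rewrite /Omega; ring. Qed.

Lemma omega_anti U V : omega V U = - omega U V.
Proof. rewrite !omega_coord; ring. Qed.

Lemma dotJ U V : dot U (J V) = - omega U V.
Proof. by rewrite /omega -(scaleN1r (J V)) dotZ mulN1r opprK. Qed.

(** The component of J U normal to the plane of U and V, multiplied by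
[sq_area U V] to clear the denominator.  Its tangential correction involves
only <J U, V> = omega(U,V), since <J U, U> = 0. *)
Definition normal_J U V : C2 R :=
  sq_area U V *: J U + omega U V *: (dot U V *: U + (- dot U U) *: V).

Lemma dot_normal_J D U V : dot D (normal_J U V) =
  - sq_area U V * omega D U +
  omega U V * (dot U V * dot D U - dot U U * dot D V).
Proof. by rewrite /normal_J !dotD !dotZ !dotD !dotZ dotJ; ring. Qed.

Lemma sq_area_sym U V : sq_area V U = sq_area U V.
Proof. by rewrite /sq_area (dotC V U) mulrC. Qed.

Lemma omega_self U : omega U U = 0.
Proof. by rewrite omega_coord; ring. Qed.

(** When U and V vary with derivatives D and E, this is the vanishing of the
derivative of omega(U,V) / sqrt (sq_area U V), cleared of denominators. *)
Definition angle_relation U V D E : Prop :=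
  2 * sq_area U V * (omega D V + omega U E) =
  omega U V * (2 * dot D U * dot V V + 2 * dot U U * dot E V
               - 2 * dot U V * (dot D V + dot U E)).

Lemma angle_relation_sym U V D E :
  angle_relation U V D E -> angle_relation V U E D.
Proof.
rewrite /angle_relation (sq_area_sym U V) (omega_anti U V).
rewrite (omega_anti U E) (omega_anti D V).
rewrite (dotC V U) (dotC E U) (dotC V D) => DE.
have -> : 2 * sq_area U V * (- omega U E + - omega D V) =
  - (2 * sq_area U V * (omega D V + omega U E)) by ring.
by rewrite DE; ring.
Qed.

(** A, B, C stand for the second derivatives X_00, X_01, X_11.  Both sides are
linear in them, and twice their difference is <U,V> times the defect of the
first relation minus <U,U> times the defect of the second.  These are the
coefficients of <U,V> U - <U,U> V, a tangent vector orthogonal to U: the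
relations are used in the direction obtained by a quarter turn. *)
Lemma Im_conj_Omega_fst U V A B C :
  angle_relation U V A B -> angle_relation U V B C ->
  sq_area U V * im_conj_mul (Omega U V) (Omega A V + Omega U B) =
  dot V V * dot A (normal_J U V) - 2 * dot U V * dot B (normal_J U V) +
    dot U U * dot C (normal_J U V).
Proof.
rewrite /angle_relation => /eqP; rewrite -subr_eq0.
set r0 := (X in X == 0) => /eqP h0 /eqP; rewrite -subr_eq0.
set r1 := (X in X == 0) => /eqP h1.
rewrite !dot_normal_J im_conj_mulDr Im_conj_Omega.
rewrite -[im_conj_mul _ (Omega U B)]im_conj_mulNN.
rewrite -(Omega_anti U V) -(Omega_anti U B).
rewrite Im_conj_Omega; apply/eqP; rewrite -subr_eq0; apply/eqP.
apply: (@mulfI _ 2); first by rewrite pnatr_eq0.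
rewrite mulr0.
(* r0 and r1 are the defects of the two relations. *)
transitivity (dot U V * r0 - dot U U * r1); last by rewrite h0 h1; ring.
rewrite /r0 /r1 [omega V U]omega_anti [dot V U]dotC /sq_area.
rewrite [omega U B]omega_anti [omega U C]omega_anti.
rewrite [dot U B]dotC [dot U C]dotC; ring.
Qed.

(** Exchanging the two coordinates changes the sign of Omega(U,V) and of its
derivatives, which leaves the left-hand side unchanged. *)
Lemma Im_conj_Omega_snd U V A B C :
  angle_relation U V A B -> angle_relation U V B C ->
  sq_area U V * im_conj_mul (Omega U V) (Omega B V + Omega U C) =
  dot V V * dot A (normal_J V U) - 2 * dot U V * dot B (normal_J V U) +
    dot U U * dot C (normal_J V U).
Proof.
move=> /angle_relation_sym AB /angle_relation_sym BC.
have := Im_conj_Omega_fst BC AB.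
rewrite (sq_area_sym U V) (dotC V U) (Omega_anti U V) (Omega_anti U C).
rewrite (Omega_anti B V) -opprD im_conj_mulNN (addrC (Omega U C)) => ->; ring.
Qed.

End HermitianAlgebra.

(** * Small matrices *)

Lemma ord2 (k : 'I_2) : k = 0 \/ k = 1.
Proof. by case: k => -[|[|//]] k2; [left|right]; exact: val_inj. Qed.

Lemma sum22 (W : nmodType) (F : 'I_2 -> 'I_2 -> W) :
  \sum_j \sum_k F j k = F 0 0 + F 0 1 + (F 1 0 + F 1 1).
Proof.
rewrite !big_ord_recl !big_ord0 !addr0.
by have -> : lift ord0 ord0 = 1 :> 'I_2 by exact: val_inj.
Qed.

Lemma invmx2 (R : realType) (G : 'M[R]_2) : G \in unitmx ->
  [/\ invmx G 0 0 = G 1 1 / \det G, invmx G 0 1 = - G 0 1 / \det G,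
      invmx G 1 0 = - G 1 0 / \det G & invmx G 1 1 = G 0 0 / \det G].
Proof.
move=> Gu.
have l00 : lift 0 0 = 1 :> 'I_2 by exact: val_inj.
have l10 : lift 1 0 = 0 :> 'I_2 by exact: val_inj.
rewrite /invmx Gu; split; rewrite !mxE /cofactor det_mx11 !mxE ?l00 ?l10 /=;
  rewrite ?expr0 ?expr1 ?expr2 /=; ring.
Qed.

Lemma det2 (R : realType) (G : 'M[R]_2) :
  \det G = G 0 0 * G 1 1 - G 0 1 * G 1 0.
Proof.
have l00 : lift 0 0 = 1 :> 'I_2 by exact: val_inj.
have l10 : lift 1 0 = 0 :> 'I_2 by exact: val_inj.
rewrite (expand_det_row _ 0) !big_ord_recl big_ord0 /cofactor !det_mx11 !mxE.
rewrite l00 l10 /= expr0 expr1; ring.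
Qed.

(** * Symmetry of second derivatives *)

Section Schwarz.
Variables (R : realType) (V : normedModType R).
Implicit Types (f : V -> R) (a b u v : V).

Lemma is_derive_line f df b u (t : R) : is_derive (t *: u + b) u f df ->
  is_derive t 1 (fun s : R => f (s *: u + b)) df.
Proof.
have E : (fun h : R => h^-1 *:
      (((fun s : R => f (s *: u + b)) \o shift t) (h *: 1) - f (t *: u + b))) =
    (fun h => h^-1 *: ((f \o shift (t *: u + b)) (h *: u) - f (t *: u + b))).
  apply/funext => h; congr (_ *: (f _ - _)).
  by rewrite /= addrA -scalerDl [h *: 1]mulr1.
by move=> [fd <-]; split; rewrite /derivable/derive E.
Qed.

(** The mean value theorem in the direction u turns the second difference into
h times an increment of the partial derivative g, which the first-order
expansion of g at a evaluates.  Only the differentiability of g at the single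
point a is involved, as in Young's form of Schwarz's theorem. *)
Lemma second_difference f g a u v :
  (\forall b \near a, is_derive b u f (g b)) ->
  differentiable g a -> forall e : R, 0 < e ->
  \forall h \near (0:R)^'+,
    `|f (h *: u + (h *: v + a)) - f (h *: v + a) - (f (h *: u + a) - f a)
      - h ^+ 2 * 'D_v g a| <= e * h ^+ 2.
Proof.
move=> fd Dd e e0.
pose K := `|u| + `|v| + 1.
have K0 : 0 < K by rewrite ltr_wpDl// addr_ge0.
(* The expansion of g is used at two points of norm at most h * K, and the
   error e1 is multiplied by h. *)
have e1_gt0 : 0 < e / (2 * K) by rewrite divr_gt0// mulr_gt0.
set e1 := e / _ in e1_gt0.
have [r r0 Hr] : exists2 r : R, 0 < r & forall x, `|x| < r ->
    is_derive (x + a) u f (g (x + a)) /\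
    `|g (x + a) - g a - 'd g a x| <= e1 * `|x|.
  suff /nbhs_norm0P : \forall x \near 0, is_derive (x + a) u f (g (x + a)) /\
      `|g (x + a) - g a - 'd g a x| <= e1 * `|x|.
    by move=> [d d0 H]; exists d.
  apply: filterI.
    move: fd; rewrite (near_shift 0 a) /=; apply: filterS => x.
    by rewrite /= subr0.
  have /diff_locally/eqaddoP/(_ e1 e1_gt0) := Dd.
  apply: filterS => x /=.
  by rewrite !fctE /= opprD addrA.
near=> h.
have h0 : 0 < h by [].
have hr : h * K < r.
  rewrite -ltr_pdivlMr//; near: h; apply: nbhs_right_lt; exact: divr_gt0.
have small (t s : R) : 0 <= t <= h -> 0 <= s <= h ->
    `|t *: u + s *: v| <= h * K.
  move=> /andP[t0 th] /andP[s0 sh].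
  rewrite (le_trans (ler_normD _ _))// !normrZ !ger0_norm// /K !mulrDr mulr1.
  rewrite -[leLHS]addr0 lerD ?lerD ?ler_wpM2r//; exact: ltW.
have hh : 0 <= h <= h by rewrite lexx ltW.
have h00 : 0 <= (0:R) <= h by rewrite lexx ltW.
pose phi (t : R) := f (t *: u + (h *: v + a)) - f (t *: u + a).
have dphi (t : R) : 0 <= t <= h ->
    is_derive t 1 phi (g (t *: u + (h *: v + a)) - g (t *: u + a)).
  move=> tT.
  have d1 : is_derive (t *: u + (h *: v + a)) u f (g (t *: u + (h *: v + a))).
    by rewrite addrA; apply: (Hr _ _).1; rewrite (le_lt_trans (small _ _ _ _)).
  have d2 : is_derive (t *: u + a) u f (g (t *: u + a)).
    apply: (Hr _ _).1; apply: le_lt_trans hr.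
    by have := small _ _ tT h00; rewrite scale0r addr0.
  by apply: is_deriveB; exact: is_derive_line.
have [t /[!in_itv]/= /andP[t0 th]||c] := @MVT R phi
    (fun t => g (t *: u + (h *: v + a)) - g (t *: u + a)) 0 h h0.
- by apply: dphi; rewrite !ltW.
- apply: derivable_within_continuous => s /[!in_itv]/= sT.
  by apply: ex_derive; exact: dphi.
rewrite in_itv/= subr0 => /andP[c0 ch] cE.
have cT : 0 <= c <= h by rewrite !ltW.
have c1 := small _ _ cT hh; have c2 := small _ _ cT h00.
rewrite scale0r addr0 in c2.
have b1 := (Hr _ (le_lt_trans c1 hr)).2.
have b2 := (Hr _ (le_lt_trans c2 hr)).2.
have -> : f (h *: u + (h *: v + a)) - f (h *: v + a) - (f (h *: u + a) - f a) =
    phi h - phi 0 by rewrite /phi scale0r !add0r; ring.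
rewrite cE (deriveE v Dd).
have Llin : 'd g a (c *: u + h *: v) = 'd g a (c *: u) + h * 'd g a v.
  by rewrite linearD [X in _ + X]linearZ.
rewrite -(addrA (c *: u)) Llin in b1.
have -> : e = e1 * (2 * K) by rewrite /e1 divfK// mulf_neq0// gt_eqF.
move: b1 b2 c1 c2; set x1 := g (_ + (_ + _)); set x2 := g (_ + a).
set x0 := g a; set l1 := 'd _ _ (_ *: _); set l2 := 'd _ _ _.
set n1 := `|c *: u + _|; set n2 := `|c *: u| => b1 b2 c1 c2.
have -> : (x1 - x2) * h - h ^+ 2 * l2 =
    h * ((x1 - x0 - (l1 + h * l2)) - (x2 - x0 - l1)).
  by ring.
rewrite normrM gtr0_norm// -mulrA mulrA.
have -> : e1 * (2 * K) * h ^+ 2 = h * (e1 * (h * K) + e1 * (h * K)) by ring.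
rewrite ler_pM2l// (le_trans (ler_normB _ _))// lerD//.
- by rewrite (le_trans b1)// ler_pM2l.
- by rewrite (le_trans b2)// ler_pM2l.
Unshelve. all: by end_near. Qed.

(** The second difference is symmetric in u and v, so its two expansions have
the same leading coefficient.  The partial derivatives are given as functions
gu and gv that agree with them near a, so that the lemma applies to the entries
of the derivatives of a matrix-valued function. *)
Lemma derive_commute f gu gv a u v :
  (\forall b \near a, is_derive b u f (gu b)) ->
  (\forall b \near a, is_derive b v f (gv b)) ->
  differentiable gu a -> differentiable gv a ->
  'D_u gv a = 'D_v gu a.
Proof.
move=> fu fv du dv; apply/eqP; rewrite -subr_eq0 -normr_le0.
apply/ler_addgt0Pl => /= e e0; rewrite addr0.
have e20 : 0 < e / 2 by rewrite divr_gt0.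
have [h [h0 [A]]] := @filter_ex _ (0:R)^'+ _ _ (filterI (nbhs_right_gt 0)
  (filterI (second_difference v fu du e20) (second_difference u fv dv e20))).
rewrite (addrCA (h *: v)).
move: A; set f2 := f (_ + (_ + _)); set f1v := f (h *: v + a).
set f1u := f (h *: u + a); set Dvu := 'D_v _ a; set Duv := 'D_u _ a => A B.
have {}A : `|f2 - f1v - (f1u - f a) - h ^+ 2 * Dvu| <= e / 2 * h ^+ 2 := A.
move: (f a) f2 f1v f1u Dvu Duv A B => fa {}f2 f1v f1u Dvu Duv A B.
have h2 : 0 < h ^+ 2 by exact: exprn_gt0.
have : `|(Duv - Dvu) * h ^+ 2| <= e / 2 * h ^+ 2 + e / 2 * h ^+ 2.
  have -> : (Duv - Dvu) * h ^+ 2 = (f2 - f1v - (f1u - fa) - h ^+ 2 * Dvu) -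
    (f2 - f1u - (f1v - fa) - h ^+ 2 * Duv) by ring.
  by rewrite (le_trans (ler_normB _ _))// lerD.
by rewrite -mulrDl -splitr normrM (gtr0_norm h2) ler_pM2r.
Qed.

End Schwarz.

Lemma is_derive_entry (R : realType) (V : normedModType R) m n
    (F : V -> 'M[R]_(m, n)) b w D j k :
  is_derive b w F D -> is_derive b w (fun c => F c j k) (D j k).
Proof.
move=> [Fd <-]; rewrite derive_mx// mxE.
by split => //; move/derivable_mxP: Fd; apply.
Qed.

Lemma derive_commute_mx (R : realType) (V : normedModType R) m n
    (f : V -> 'M[R]_(m, n)) (a u v : V) :
  (\forall b \near a, differentiable f b) ->
  differentiable ('D_u f) a -> differentiable ('D_v f) a ->
  'D_u ('D_v f) a = 'D_v ('D_u f) a.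
Proof.
move=> fd du dv.
have fder w : \forall b \near a, is_derive b w f ('D_w f b).
  by apply: filterS fd => b fb; split => //; exact: diff_derivable.
have second w w' j k : differentiable ('D_w' f) a ->
    'D_w ('D_w' f) a j k = 'D_w (fun c => 'D_w' f c j k) a.
  by move=> dw; rewrite derive_mx ?mxE//; exact: diff_derivable.
have entry w j k : differentiable ('D_w f) a ->
    differentiable (fun c => 'D_w f c j k) a.
  move=> dw.
  exact: (@differentiable_comp _ _ _ _ ('D_w f) (fun N : 'M[R]_(m, n) => N j k)
   a dw (differentiable_coord _ j k)).
have E j k : 'D_u (fun c => 'D_v f c j k) a = 'D_v (fun c => 'D_u f c j k) a.
  apply: (@derive_commute R V (fun c => f c j k)).
  - by apply: filterS (fder u) => b fb; exact: is_derive_entry.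
  - by apply: filterS (fder v) => b fb; exact: is_derive_entry.
  - exact: entry.
  - exact: entry.
apply/matrixP => j k.
exact: etrans (second u v j k dv) (etrans (E j k) (esym (second v u j k du))).
Qed.

(** * Derivatives of bilinear forms, of composites and of square roots *)

Section BilinearDerivative.
Variables (R : realType) (V : normedModType R) (n : nat).
Implicit Types F G : V -> 'rV[R]_n.

Definition bilinear_form (phi : 'rV[R]_n -> 'rV[R]_n -> R) :=
  (forall W, scalar (phi^~ W)) /\ (forall U, scalar (phi U)).

Lemma scalar_expand (f : 'rV[R]_n -> R) U : scalar f ->
  f U = \sum_j U 0 j * f 'e_j.
Proof.
move=> fl; pose l : {linear 'rV[R]_n -> R | *%R} :=
  HB.pack f (GRing.isLinear.Build _ _ _ _ f fl).
rewrite -[LHS]/(l U) [in LHS](row_sum_delta U) linear_sum.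
by apply: eq_bigr => j _; rewrite linearZ.
Qed.

Lemma bilinear_form_expand phi U W : bilinear_form phi ->
  phi U W = \sum_j \sum_k phi 'e_j 'e_k * (U 0 j * W 0 k).
Proof.
move=> [phil phir].
rewrite (scalar_expand U (phil W)); apply: eq_bigr => j _.
rewrite (scalar_expand W (phir 'e_j)) mulr_sumr; apply: eq_bigr => k _; ring.
Qed.

Lemma is_derive_bilinear phi F G dF dG a v : bilinear_form phi ->
  is_derive a v F dF -> is_derive a v G dG ->
  is_derive a v (fun b => phi (F b) (G b)) (phi dF (G a) + phi (F a) dG).
Proof.
move=> bphi Fd Gd.
have -> : (fun b => phi (F b) (G b)) = \sum_j \sum_k
    (phi 'e_j 'e_k \*: ((fun b => F b 0 j) * (fun b => G b 0 k))).
  apply/funext => b; rewrite bilinear_form_expand// fct_sumE.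
  by apply: eq_bigr => j _; rewrite fct_sumE.
have Fe j := is_derive_entry 0 j Fd; have Ge k := is_derive_entry 0 k Gd.
apply: is_derive_eq.
rewrite [X in _ = X + _]bilinear_form_expand//.
rewrite [X in _ = _ + X]bilinear_form_expand//.
rewrite -big_split; apply: eq_bigr => j _; rewrite -big_split.
by apply: eq_bigr => k _; rewrite /GRing.scale /=; ring.
Qed.

Lemma differentiable_bilinear phi F G a : bilinear_form phi ->
  differentiable F a -> differentiable G a ->
  differentiable (fun b => phi (F b) (G b)) a.
Proof.
move=> bphi Fd Gd.
have -> : (fun b => phi (F b) (G b)) = \sum_j \sum_k
    (phi 'e_j 'e_k \*: ((fun b => F b 0 j) * (fun b => G b 0 k))).
  apply/funext => b; rewrite bilinear_form_expand// fct_sumE.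
  by apply: eq_bigr => j _; rewrite fct_sumE.
have entry (H : V -> 'rV[R]_n) j : differentiable H a ->
    differentiable (fun b => H b 0 j) a.
  move=> Hd.
  exact: (@differentiable_comp _ _ _ _ H (fun N : 'rV[R]_n => N 0 j)
   a Hd (differentiable_coord _ 0 j)).
apply: differentiable_sum => j; apply: differentiable_sum => k.
apply: differentiableZ; apply: differentiableM; exact: entry.
Qed.

End BilinearDerivative.

Section Forms.
Variable R : realType.

Lemma dot_bilinear : bilinear_form (@dot R).
Proof.
by split=> W a U V; rewrite !dot_coord !mxE /=; ring.
Qed.

Lemma omega_bilinear : bilinear_form (@omega R).
Proof.
by split=> W a U V; rewrite !omega_coord !mxE /=; ring.
Qed.

Lemma Re_Omega_bilinear :
  bilinear_form (fun U V : C2 R => complex.Re (Omega U V)).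
Proof.
by split=> W a U V; cbv beta; rewrite !Re_Omega !mxE /=; ring.
Qed.

Lemma Im_Omega_bilinear :
  bilinear_form (fun U V : C2 R => complex.Im (Omega U V)).
Proof.
by split=> W a U V; cbv beta; rewrite !Im_Omega !mxE /=; ring.
Qed.

End Forms.

Lemma near_eq_differentiable (R : realType) (V W : normedModType R)
    (f g : V -> W) (a : V) :
  (\forall b \near a, f b = g b) -> differentiable f a -> differentiable g a.
Proof.
move=> fg fd; have fga := nbhs_singleton fg.
have gE : g \o shift a = cst (g a) + 'd f a +o_ 0 id.
  apply/eqaddoP => e e0.
  have /diff_locally/eqaddoP/(_ e e0) := fd.
  move: fg; rewrite (near_shift 0 a) /= => fg; apply: filterS2 fg => x.
  by rewrite /= !fctE /= subr0 => <-; rewrite fga.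
have fc : continuous ('d f a) by exact: diff_continuous.
by apply/diff_locallyP; rewrite (diff_unique fc gE).
Qed.

Lemma is_derive_real_comp (R : realType) (V : normedModType R)
    (q : V -> R) (h : R -> R) (a v : V) (dh : R) :
  differentiable q a -> is_derive (q a) 1 h dh ->
  is_derive a v (h \o q) (dh * 'D_v q a).
Proof.
move=> qd [/derivable1_diffP hd <-].
have hq : differentiable (h \o q) a by exact: differentiable_comp.
split; first exact: diff_derivable.
rewrite !deriveE// diff_comp//= -[X in 'd h _ X = _]mulr1.
by rewrite [LHS]linearZ mulrC.
Qed.

(** Obtained by differentiating f^2 = k^2 g, which avoids the square root.  If
f a = 0 this equation says nothing about df: then either k = 0 and f is 0 near
a, or g a = 0 as well. *)
Lemma derive_const_ratio (R : realType) (V : normedModType R) (k : R)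
    (f g : V -> R) (a v : V) (df dg : R) :
  (\forall c \near a, f c = k * Num.sqrt (g c)) ->
  (\forall c \near a, 0 <= g c) ->
  is_derive a v f df -> is_derive a v g dg -> 2 * g a * df = f a * dg.
Proof.
move=> fg g0 fD gD.
have fa := nbhs_singleton fg; have ga := nbhs_singleton g0.
have [k0|k0] := eqVneq k 0.
  rewrite fa k0 mul0r; rewrite mul0r.
  have f0 : \forall c \near a, cst 0 c = f c.
    by apply: filterS fg => c ->; rewrite k0 mul0r.
  have [_ <-] := fD; rewrite -(near_eq_derive v f0) derive_cst mulr0 //.
have f2 : \forall c \near a, (f ^+ 2) c = (k ^+ 2 \*: g) c.
  apply: filterS2 fg g0 => c fc gc; rewrite exprfctE fc exprMn sqr_sqrtr//.
have [_ D1] : is_derive a v (f ^+ 2) (2 * f a * df).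
  by apply: is_derive_eq; rewrite expr1.
have [_ D2] : is_derive a v (k ^+ 2 \*: g) (k ^+ 2 * dg) by apply: is_derive_eq.
have D : 2 * f a * df = k ^+ 2 * dg by rewrite -D1 -D2; exact: near_eq_derive.
have f2a : f a ^+ 2 = k ^+ 2 * g a by rewrite fa exprMn sqr_sqrtr.
have [fa0|fa0] := eqVneq (f a) 0.
  have ga0 : g a = 0.
    apply/eqP; move/eqP: f2a.
    by rewrite fa0 expr0n eq_sym mulf_eq0 sqrf_eq0 (negPf k0).
  by rewrite ga0 fa0 !mulr0 !mul0r.
apply: (mulfI fa0).
have -> : f a * (2 * g a * df) = g a * (2 * f a * df) by ring.
by rewrite D [RHS]mulrA -expr2 f2a; ring.
Qed.

(** * Arguments of plane vectors *)

Section Polar.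
Variable R : realType.
Implicit Types f g r s t : R.

(** The modulus is existential so that multiplying f + i g by a positive density
visibly preserves its arguments; at the origin every t is one. *)
Definition polar f g t := exists2 r, 0 <= r & f = r * cos t /\ g = r * sin t.

Lemma polarP (z : R[i]) t :
  z = `|z| * Complex (cos t) (sin t) <-> polar (complex.Re z) (complex.Im z) t.
Proof.
split=> [->|[r r0 []]].
  rewrite normc_def; simpc; rewrite /=.
  by exists (Num.sqrt (complex.Re z ^+ 2 + complex.Im z ^+ 2)).
case: z => f g /= -> ->; rewrite normc_def /= !exprMn -mulrDr cos2Dsin2 mulr1.
by rewrite sqrtr_sqr ger0_norm//; simpc.
Qed.

Lemma polar_exists f g : exists t, polar f g t.
Proof.
have [fg0|fg0] := eqVneq (f ^+ 2 + g ^+ 2) 0.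
  exists 0; exists 0 => //; rewrite !mul0r.
  move: fg0 => /eqP; rewrite paddr_eq0 ?sqr_ge0// !sqrf_eq0.
  by move=> /andP[/eqP-> /eqP->].
have r20 : 0 < f ^+ 2 + g ^+ 2 by rewrite lt0r fg0 addr_ge0 ?sqr_ge0.
pose r := Num.sqrt (f ^+ 2 + g ^+ 2).
have r0 : 0 < r by rewrite sqrtr_gt0.
have r2 : r ^+ 2 = f ^+ 2 + g ^+ 2 by rewrite sqr_sqrtr// ltW.
have fr : -1 <= f / r <= 1.
  rewrite -ler_norml normrM normfV (gtr0_norm r0) ler_pdivrMr// mul1r.
  by rewrite -[leLHS]sqrtr_sqr ler_sqrt ?lerDl ?sqr_ge0// ltW.
have sE : Num.sqrt (1 - (f / r) ^+ 2) = `|g| / r.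
  have -> : `|g| / r = Num.sqrt ((`|g| / r) ^+ 2).
    by rewrite sqrtr_sqr [RHS]ger0_norm// divr_ge0// ltW.
  congr Num.sqrt.
  rewrite !exprMn !exprVn real_normK ?num_real//.
  rewrite -[1](@divff _ (r ^+ 2)) ?gt_eqF ?exprn_gt0//.
  by rewrite -mulrBl r2; congr (_ / _); ring.
have cE : cos (acos (f / r)) = f / r by rewrite acosK// in_itv.
have [g0|g0] := leP 0 g.
- exists (acos (f / r)); exists r; first exact: ltW.
  by rewrite cE sin_acos// sE ger0_norm// !(mulrC r) !divfK ?gt_eqF.
- exists (- acos (f / r)); exists r; first exact: ltW.
  rewrite cosN sinN cE sin_acos// sE ltr0_norm// mulNr opprK.
  by rewrite !(mulrC r) !divfK ?gt_eqF.
Qed.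

Lemma polar_scale f g t k : 0 <= k -> polar f g t -> polar (k * f) (k * g) t.
Proof.
move=> k0 [r r0 [-> ->]]; exists (k * r); first exact: mulr_ge0.
by rewrite !mulrA.
Qed.

(** The quotient is q = Im (conj z0 z) / Re (conj z0 z), so z is a positive
multiple of z0 (1 + i q), and e^(i atan q) = (1 + i q) / sqrt (1 + q^2). *)
Lemma polar_atan f0 g0 t0 f g : polar f0 g0 t0 -> 0 < f0 * f + g0 * g ->
  polar f g (t0 + atan ((f0 * g - g0 * f) / (f0 * f + g0 * g))).
Proof.
move=> [r r0 [f0E g0E]]; set re := _ + _; set im := _ - _ => re0.
have r2E : f0 ^+ 2 + g0 ^+ 2 = r ^+ 2.
  by rewrite f0E g0E !exprMn -mulrDr cos2Dsin2 mulr1.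
have {}r0 : 0 < r.
  rewrite lt0r r0 andbT; apply: contraTneq re0 => r0'.
  by rewrite /re f0E g0E r0' !mul0r addr0 ltxx.
set q := im / re; have Ec := cos_atan q.
have c0 : 0 < cos (atan q) by rewrite Ec invr_gt0 sqrtr_gt0 ltr_pwDl ?sqr_ge0.
have Es : sin (atan q) = q * cos (atan q).
  by rewrite -{2}(atanK q) /tan divfK// gt_eqF.
exists (re / (r * cos (atan q))); first by rewrite ltW// divr_gt0// mulr_gt0.
have qre : q * re = im by rewrite divfK// gt_eqF.
have rn0 : r != 0 by rewrite gt_eqF.
have cn0 : cos (atan q) != 0 by rewrite gt_eqF.
rewrite cosD sinD Es.
have -> : cos t0 = f0 / r by rewrite f0E mulrAC divff// mul1r.
have -> : sin t0 = g0 / r by rewrite g0E mulrAC divff// mul1r.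
clear Ec Es c0.
move: (cos _) cn0 => c cn0.
have -> : re / (r * c) * (f0 / r * c - g0 / r * (q * c)) =
   (re * f0 - (q * re) * g0) / r ^+ 2 by field; rewrite cn0 rn0.
have -> : re / (r * c) * (g0 / r * c + f0 / r * (q * c)) =
   (re * g0 + (q * re) * f0) / r ^+ 2 by field; rewrite cn0 rn0.
rewrite qre -r2E.
have D : f0 ^+ 2 + g0 ^+ 2 != 0 by rewrite r2E sqrf_eq0.
by split; rewrite /re /im; field.
Qed.

(** Here conj z0 z = r0 r e^(i (t - t0)), so the quotient is tan (t - t0). *)
Lemma polar_unique f0 g0 t0 f g t : polar f0 g0 t0 -> polar f g t ->
  0 < f0 * f + g0 * g -> `|t - t0| < pi / 2 ->
  t = t0 + atan ((f0 * g - g0 * f) / (f0 * f + g0 * g)).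
Proof.
move=> [r0 r0_ge0 [-> ->]] [r r_ge0 [-> ->]].
have -> : r0 * cos t0 * (r * cos t) + r0 * sin t0 * (r * sin t) =
  (r0 * r) * cos (t - t0) by rewrite cosB; ring.
have -> : r0 * cos t0 * (r * sin t) - r0 * sin t0 * (r * cos t) =
  (r0 * r) * sin (t - t0) by rewrite sinB; ring.
move=> re0 tt0.
have rr0 : r0 * r != 0.
  by apply: contraTneq re0 => ->; rewrite mul0r ltxx.
rewrite -mulf_div divff// mul1r -[sin _ / _]/(tan _) tanK.
  by rewrite addrC subrK.
by rewrite in_itv /= -ltr_norml.
Qed.

End Polar.

Section AngleDerivative.
Variables (R : realType) (V : normedModType R).
Variables (f g b : V -> R) (a : V).
Hypothesis fd : differentiable f a.
Hypothesis gd : differentiable g a.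
Hypothesis ba : {for a, continuous b}.
Hypothesis fgb : \forall c \near a, polar (f c) (g c) (b c).
Hypothesis fg0 : 0 < f a ^+ 2 + g a ^+ 2.

Let re c := f a * f c + g a * g c.
Let im c := f a * g c - g a * f c.

Let re_gt0 : 0 < re a. Proof. by rewrite /re -!expr2. Qed.

Let re_d : differentiable re a.
Proof. by apply: differentiableD; apply: differentiableZ. Qed.

Let im_d : differentiable im a.
Proof. by apply: differentiableB; apply: differentiableZ. Qed.

Let q_d : differentiable (fun c => im c / re c) a.
Proof.
apply: differentiableM => //; apply: differentiableV => //.
by rewrite gt_eqF.
Qed.

Let angle_near : \forall c \near a, b a + atan (im c / re c) = b c.
Proof.
have bc : \forall c \near a, `|b c - b a| < pi / 2.
  have /cvgrPdist_lt := ba; move=> /(_ (pi / 2)).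
  rewrite divr_gt0 ?pi_gt0// => /(_ isT).
  by apply: filterS => c; rewrite distrC.
have rec : \forall c \near a, 0 < re c.
  have /cvgrPdist_lt := differentiable_continuous re_d.
  move=> /(_ _ re_gt0); apply: filterS => c; rewrite ltr_norml => /andP[_].
  by rewrite ltrBlDr ltrDl.
near=> c.
apply/esym/polar_unique.
- exact: nbhs_singleton fgb.
- by near: c.
- by near: c.
- by near: c.
Unshelve. all: by end_near. Qed.

Let angle_d : differentiable (fun c => b a + atan (im c / re c)) a.
Proof.
apply: differentiableD => //; apply: (differentiable_comp q_d).
exact/derivable1_diffP/derivable_atan.
Qed.

Lemma differentiable_angle : differentiable b a.
Proof. exact: near_eq_differentiable angle_near angle_d. Qed.

(** Since im a = 0, the derivative of atan (im / re) at a is the derivative of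
im divided by re a = |f + i g|^2. *)
Lemma derive_angle v :
  (f a ^+ 2 + g a ^+ 2) * 'D_v b a = f a * 'D_v g a - g a * 'D_v f a.
Proof.
have fdv : derivable f a v by exact: diff_derivable.
have gdv : derivable g a v by exact: diff_derivable.
have im0 : im a = 0 by rewrite /im mulrC subrr.
have re0 : re a != 0 by rewrite gt_eqF.
have imD : is_derive a v im (f a * 'D_v g a - g a * 'D_v f a).
  have fD := derivableP fdv; have gD := derivableP gdv.
  by apply: is_deriveB; apply: is_deriveZ.
have red : derivable re a v by exact: diff_derivable.
have qD : is_derive a v (im * (fun c => (re c)^-1))
    ((f a * 'D_v g a - g a * 'D_v f a) / re a).
  have reVD : is_derive a v (fun c => (re c)^-1) (- (re a) ^- 2 *: 'D_v re a).
    by split; [exact: derivableV | rewrite deriveV].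
  apply: is_derive_eq.
  by rewrite im0 scale0r add0r /GRing.scale /= mulrC.
have [atanD atanE] := is_derive_real_comp v q_d (is_derive1_atan _).
rewrite -(near_eq_derive v angle_near).
rewrite deriveD ?derive_cst ?add0r//.
rewrite atanE im0 mul0r expr0n addr0 invr1 mul1r.
rewrite (@derive_val _ _ _ _ _ _ _ qD).
by rewrite mulrC -[X in _ / X * _]/(re a) /re -!expr2 divfK// gt_eqF.
Qed.

End AngleDerivative.

(** * The tangent frame of a chart *)

Section Frame.
Variables (R : realType) (M : oriented_surface R) (x : M -> C2 R).
Variables (i : atlas M) (p : M).
Hypothesis inj : injective (tdiff i p x).

Local Notation U := (tdiff i p x 'e_0).
Local Notation V := (tdiff i p x 'e_1).
Local Notation g := (sq_area U V).

Lemma det_gram : \det (gram x i p) = g.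
Proof.
by rewrite det2 !mxE /metric /sq_area expr2; congr (_ - _ * _); exact: dotC.
Qed.

Lemma sq_area_gt0 : 0 < g.
Proof. by rewrite -det_gram; exact: det_gram_gt0. Qed.

Lemma volume_form_sq_area : volume_form x i p 'e_0 'e_1 = Num.sqrt g.
Proof. by rewrite /volume_form det_gram det_frame !mxE /=; ring. Qed.

(** Dividing Omega(U,V) by the positive number sqrt g does not change its
argument, so the square root never has to be differentiated. *)
Lemma lagrangian_angleP t : lagrangian_angle x i p t <->
  polar (complex.Re (Omega U V)) (complex.Im (Omega U V)) t.
Proof.
rewrite /lagrangian_angle /mkset /Defs.eta volume_form_sq_area.
have r0 : 0 < Num.sqrt g by rewrite sqrtr_gt0 sq_area_gt0.
move: (Num.sqrt _) r0 (Omega _ _) => r r0 [u v].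
apply: (iff_trans (polarP _ _)).
have -> : Complex u v / (real_complex R r) = Complex (r^-1 * u) (r^-1 * v).
  by rewrite -fmorphV; simpc; rewrite !(mulrC r^-1).
split=> /=.
  by move=> /(polar_scale (ltW r0)); rewrite !mulrA !divff ?gt_eqF// !mul1r.
by apply: polar_scale; rewrite invr_ge0 ltW.
Qed.

Lemma gram_inv : [/\ invmx (gram x i p) 0 0 = dot V V / g,
   invmx (gram x i p) 0 1 = - dot U V / g,
   invmx (gram x i p) 1 0 = - dot U V / g
   & invmx (gram x i p) 1 1 = dot U U / g].
Proof.
have [] := invmx2 (gram_unit inj).
rewrite det_gram ![gram x i p _ _]mxE /metric.
by rewrite [dot V U]dotC.
Qed.

Lemma dot_normal D T : g * dot (normal x i p D) T = g * dot D T -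
  ((dot V V * dot D U - dot U V * dot D V) * dot U T +
   (dot U U * dot D V - dot U V * dot D U) * dot V T).
Proof.
have [i00 i01 i10 i11] := gram_inv.
have tE : dot (tangential x i p D) T =
  ((dot V V * dot D U - dot U V * dot D V) * dot U T +
   (dot U U * dot D V - dot U V * dot D U) * dot V T) / g.
  rewrite /tangential tdiff_sum !big_ord_recl big_ord0 addr0.
  have -> : lift ord0 ord0 = 1 :> 'I_2 by exact: val_inj.
  rewrite dotC dotD !dotZ !mxE !big_ord_recl !big_ord0 !addr0.
  have -> : lift ord0 ord0 = 1 :> 'I_2 by exact: val_inj.
  rewrite !mxE i00 i01 i10 i11 [dot T U]dotC [dot T V]dotC; ring.
have g0 : g != 0 by rewrite gt_eqF// sq_area_gt0.
rewrite /normal dotC dotD -scaleN1r dotZ mulN1r mulrDr ![dot T _]dotC tE.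
by rewrite mulrN mulrCA divff// mulr1.
Qed.

Lemma dot_mean_curvature T :
  g * dot (mean_curvature x i p) T =
  dot V V * dot (second_form x i p 'e_0 'e_0) T -
  dot U V * dot (second_form x i p 'e_0 'e_1) T -
  dot U V * dot (second_form x i p 'e_1 'e_0) T +
  dot U U * dot (second_form x i p 'e_1 'e_1) T.
Proof.
have [i00 i01 i10 i11] := gram_inv.
have g0 : g != 0 by rewrite gt_eqF// sq_area_gt0.
rewrite /mean_curvature sum22.
rewrite i00 i01 i10 i11; clear i00 i01 i10 i11.
move: (second_form _ _ _ 'e_0 'e_0) (second_form _ _ _ 'e_0 'e_1)
  (second_form _ _ _ 'e_1 'e_0) (second_form _ _ _ 'e_1 'e_1) => A B B' C.
move: (sq_area U V) (dot V V) (dot U V) (dot U U) g0 => g vv uv uu g0.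
rewrite dotC !dotD !dotZ ![dot T _]dotC.
by field.
Qed.

Lemma dot_normal_J0 D : g * dot (normal x i p D) (J U) = dot D (normal_J U V).
Proof.
rewrite dot_normal dot_normal_J !dotJ omega_self (omega_anti U V).
move: (omega D U) (sq_area U V) => a b; ring.
Qed.

Lemma dot_normal_J1 D : g * dot (normal x i p D) (J V) = dot D (normal_J V U).
Proof.
rewrite dot_normal dot_normal_J !dotJ omega_self (omega_anti U V) (dotC V U).
rewrite (sq_area_sym U V); move: (omega D V) (sq_area U V) => a b; ring.
Qed.

Lemma dot_mean_curvature_J0 :
  ambient_derivative x i p 'e_1 'e_0 = ambient_derivative x i p 'e_0 'e_1 ->
  g * (g * dot (mean_curvature x i p) (J U)) =
  dot V V * dot (ambient_derivative x i p 'e_0 'e_0) (normal_J U V) -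
  2 * dot U V * dot (ambient_derivative x i p 'e_0 'e_1) (normal_J U V) +
  dot U U * dot (ambient_derivative x i p 'e_1 'e_1) (normal_J U V).
Proof.
rewrite dot_mean_curvature /second_form => ->.
move: (ambient_derivative _ _ _ _ _) (ambient_derivative _ _ _ _ _)
  (ambient_derivative _ _ _ _ _) => A B C.
have /esym A_J := dot_normal_J0 A; have /esym B_J := dot_normal_J0 B.
have /esym C_J := dot_normal_J0 C.
rewrite A_J B_J C_J.
move: (sq_area U V) (dot (normal x i p A) _) (dot (normal x i p B) _) => a b c.
by move: (dot (normal x i p C) _) (dot V V) (dot U V) (dot U U) => *; ring.
Qed.

Lemma dot_mean_curvature_J1 :
  ambient_derivative x i p 'e_1 'e_0 = ambient_derivative x i p 'e_0 'e_1 ->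
  g * (g * dot (mean_curvature x i p) (J V)) =
  dot V V * dot (ambient_derivative x i p 'e_0 'e_0) (normal_J V U) -
  2 * dot U V * dot (ambient_derivative x i p 'e_0 'e_1) (normal_J V U) +
  dot U U * dot (ambient_derivative x i p 'e_1 'e_1) (normal_J V U).
Proof.
rewrite dot_mean_curvature /second_form => ->.
move: (ambient_derivative _ _ _ _ _) (ambient_derivative _ _ _ _ _)
  (ambient_derivative _ _ _ _ _) => A B C.
have /esym A_J := dot_normal_J1 A; have /esym B_J := dot_normal_J1 B.
have /esym C_J := dot_normal_J1 C.
rewrite A_J B_J C_J.
move: (sq_area U V) (dot (normal x i p A) _) (dot (normal x i p B) _) => a b c.
by move: (dot (normal x i p C) _) (dot V V) (dot U V) (dot U U) => *; ring.
Qed.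

End Frame.

(** * Differentiating the constant angle condition *)

Section PartialDerivatives.
Variables (R : realType) (M : oriented_surface R) (x : M -> C2 R).
Hypothesis x_imm : smooth_immersion x.
Variables (i : atlas M) (p : M).
Hypothesis ip : dom i p.

Definition partial (j : atlas M) (k : 'I_2) : 'rV[R]_2 -> C2 R :=
  'D_('e_k) (x \o param j).

Lemma chart_nbhs : \forall c \near chart i p, (chart i @` dom i) c.
Proof. by apply: open_nbhs_nbhs; split; [exact: chart_open | exists p]. Qed.

Lemma differentiable_param : differentiable (x \o param i) (chart i p).
Proof. by have [+ _] := x_imm.1 i 1%N; apply; exists p. Qed.

Lemma differentiable_partial k : differentiable (partial i k) (chart i p).
Proof. by have [_ /(_ 'e_k)[+ _]] := x_imm.1 i 2%N; apply; exists p. Qed.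

Lemma tdiff_partial k : tdiff i p x 'e_k = partial i k (chart i p).
Proof. by rewrite /partial deriveE//; exact: differentiable_param. Qed.

Lemma is_derive_partial j k : is_derive (chart i p) 'e_j (partial i k)
  (ambient_derivative x i p 'e_j 'e_k).
Proof. by apply/derivableP/diff_derivable; exact: differentiable_partial. Qed.

Lemma ambient_derivative_sym j k :
  ambient_derivative x i p 'e_j 'e_k = ambient_derivative x i p 'e_k 'e_j.
Proof.
apply: derive_commute_mx; try exact: differentiable_partial.
by apply: filterS chart_nbhs => c [q iq <-]; have [+ _] := x_imm.1 i 1%N; apply;
  exists q.
Qed.

End PartialDerivatives.

Section ConstantAngle.
Variables (R : realType) (M : oriented_surface R) (x : M -> C2 R).
Hypothesis x_imm : smooth_immersion x.
Variable theta : R.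
Hypothesis theta_const : is_kahler_angle x (cst theta).
Variables (i : atlas M) (p : M).
Hypothesis ip : dom i p.

Local Notation U := (tdiff i p x 'e_0).
Local Notation V := (tdiff i p x 'e_1).
Local Notation g := (sq_area U V).
Local Notation D2 := (fun j k => ambient_derivative x i p 'e_j 'e_k).

Lemma omega_sq_area q (iq : dom i q) :
  omega (tdiff i q x 'e_0) (tdiff i q x 'e_1) =
  cos theta * Num.sqrt (sq_area (tdiff i q x 'e_0) (tdiff i q x 'e_1)).
Proof.
by rewrite (theta_const q).2// volume_form_sq_area.
Qed.

Lemma normsq_Omega_sin :
  complex.Re (Omega U V) ^+ 2 + complex.Im (Omega U V) ^+ 2 =
  sin theta ^+ 2 * g.
Proof.
rewrite normsq_Omega (omega_sq_area ip) exprMn sqr_sqrtr; last first.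
  by apply/ltW/sq_area_gt0; exact: x_imm.2.
by rewrite sin2cos2; ring.
Qed.

(** The Kaehler angle enters the proof only here and in the norm of
Omega(U,V): omega(U,V) / sqrt g is the constant cos theta on the chart. *)
Lemma angle_relation_partials k : angle_relation U V (D2 k 0) (D2 k 1).
Proof.
pose X0 := partial x i 0; pose X1 := partial x i 1.
have D0 := is_derive_partial x_imm ip k 0.
have D1 := is_derive_partial x_imm ip k 1.
have wD := is_derive_bilinear (@omega_bilinear R) D0 D1.
have d00 := is_derive_bilinear (@dot_bilinear R) D0 D0.
have d01 := is_derive_bilinear (@dot_bilinear R) D0 D1.
have d11 := is_derive_bilinear (@dot_bilinear R) D1 D1.
have gD := is_deriveB (is_deriveM d00 d11) (is_deriveX 2 d01).
have onchart (P : C2 R -> C2 R -> Prop) :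
    (forall q, dom i q -> P (tdiff i q x 'e_0) (tdiff i q x 'e_1)) ->
    \forall c \near chart i p, P (X0 c) (X1 c).
  move=> Pq; apply: filterS (chart_nbhs ip) => c [q iq <-].
  by rewrite /X0 /X1 -!(tdiff_partial x_imm iq); exact: Pq.
have := derive_const_ratio (k := cos theta)
  (onchart (fun A B => omega A B = cos theta * Num.sqrt (sq_area A B)) _)
  (onchart (fun A B => 0 <= sq_area A B) _) wD gD.
rewrite /X0 /X1 -!(tdiff_partial x_imm ip).
move=> ratio; rewrite /angle_relation.
apply: etrans (ratio _ _) _ => [q iq|q iq|].
- exact: omega_sq_area.
- by apply/ltW/sq_area_gt0; exact: x_imm.2.
- move: (ambient_derivative _ _ _ _ 'e_0) (ambient_derivative _ _ _ _ 'e_1).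
  move: U V => X Y A B.
  by rewrite [dot Y B]dotC [dot X A]dotC /GRing.scale /= expr1; ring.
Qed.

(** The geometric core: the mean curvature in the direction J X_k is the
rotation speed of the argument of Omega(U,V) along X_k, up to the factor
|Omega(U,V)|^2 / g. *)
Lemma mean_curvature_Omega k :
  g * dot (mean_curvature x i p) (J (tdiff i p x 'e_k)) =
  im_conj_mul (Omega U V) (Omega (D2 k 0) V + Omega U (D2 k 1)).
Proof.
have inj := x_imm.2 i p ip.
have g0 : g != 0 by rewrite gt_eqF// sq_area_gt0.
have symD : D2 1 0 = D2 0 1 by exact: ambient_derivative_sym.
have R0 := angle_relation_partials 0; have R1 := angle_relation_partials 1.
apply: (mulfI g0); have [->|->] := ord2 k.
- rewrite (dot_mean_curvature_J0 inj symD); move: symD R0 R1.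
  move: (ambient_derivative _ _ _ 'e_0 'e_0)
    (ambient_derivative _ _ _ 'e_0 'e_1) (ambient_derivative _ _ _ 'e_1 'e_0)
    (ambient_derivative _ _ _ 'e_1 'e_1).
  by move=> A B _ C -> R0 R1; apply/esym/Im_conj_Omega_fst.
- rewrite (dot_mean_curvature_J1 inj symD); move: symD R0 R1.
  move: (ambient_derivative _ _ _ 'e_0 'e_0)
    (ambient_derivative _ _ _ 'e_0 'e_1) (ambient_derivative _ _ _ 'e_1 'e_0)
    (ambient_derivative _ _ _ 'e_1 'e_1).
  by move=> A B _ C -> R0 R1; apply/esym/Im_conj_Omega_snd.
Qed.

End ConstantAngle.

(** * The differential of the Lagrangian angle *)

Section LagrangianAngle.
Variables (R : realType) (M : oriented_surface R) (x : M -> C2 R).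
Hypothesis x_imm : smooth_immersion x.
Variables (i : atlas M) (p : M).
Hypothesis ip : dom i p.

(** Real and imaginary parts of the density of Omega with respect to the
coordinate area element of the chart, as functions of the coordinates. *)
Definition Re_density c :=
  complex.Re (Omega (partial x i 0 c) (partial x i 1 c)).

Definition Im_density c :=
  complex.Im (Omega (partial x i 0 c) (partial x i 1 c)).

Lemma differentiable_Re_density : differentiable Re_density (chart i p).
Proof.
by apply: (differentiable_bilinear (@Re_Omega_bilinear R));
  exact: differentiable_partial.
Qed.

Lemma differentiable_Im_density : differentiable Im_density (chart i p).
Proof.
by apply: (differentiable_bilinear (@Im_Omega_bilinear R));
  exact: differentiable_partial.
Qed.

Lemma polar_density t : lagrangian_angle x i p t <->
  polar (Re_density (chart i p)) (Im_density (chart i p)) t.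
Proof.
rewrite /Re_density /Im_density -!(tdiff_partial x_imm ip).
exact/lagrangian_angleP/x_imm.2.
Qed.

End LagrangianAngle.

Section LagrangianAngleDerivative.
Variables (R : realType) (M : oriented_surface R) (x : M -> C2 R).
Hypothesis x_imm : smooth_immersion x.
Variables (i : atlas M) (p : M).
Hypothesis ip : dom i p.

Local Notation f := (Re_density x i).
Local Notation g := (Im_density x i).
Local Notation a := (chart i p).
Hypothesis fg0 : 0 < f a ^+ 2 + g a ^+ 2.

(** The arctangent formula of [polar_atan] stays continuous as long as
conj (N p) * N has positive real part, hence near p. *)
Lemma angle_lift_exists : exists b, angle_lift x i p b.
Proof.
have [t tP] := polar_exists (f a) (g a).
pose re c := f a * f c + g a * g c.
pose im c := f a * g c - g a * f c.
have re_d q : dom i q -> differentiable re (chart i q).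
  move=> iq; apply: differentiableD; apply: differentiableZ.
    exact: differentiable_Re_density.
  exact: differentiable_Im_density.
have im_d q : dom i q -> differentiable im (chart i q).
  move=> iq; apply: differentiableB; apply: differentiableZ.
    exact: differentiable_Im_density.
  exact: differentiable_Re_density.
exists (fun q => t + atan (im (chart i q) / re (chart i q))).
have re_p : 0 < re (chart i p) by rewrite /re -!expr2.
have dom_near : \forall q \near p, dom i q.
  by apply: open_nbhs_nbhs; split => //; exact: dom_open.
have re_near : \forall q \near p, 0 < re (chart i q).
  have rec : {for p, continuous (re \o chart i)}.
    apply: continuous_comp; first exact: chart_continuous.
    exact/differentiable_continuous/re_d.
  move/cvgrPdist_lt : rec => /(_ _ re_p); apply: filterS => q /=.
  by rewrite ltr_norml => /andP[_]; rewrite ltrBlDr ltrDl.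
apply: filterS2 dom_near re_near => q iq req; split; last first.
  by apply/(polar_density x_imm iq); exact: polar_atan.
apply: (@continuous_comp _ _ _ (chart i) (fun c => t + atan (im c / re c))).
  exact: chart_continuous.
apply: differentiable_continuous.
apply: differentiableD; first exact: differentiable_cst.
apply: (@differentiable_comp _ _ _ _ (fun c => im c / re c) atan).
  apply: differentiableM; first exact: im_d.
  by apply: differentiableV; [exact: re_d | rewrite gt_eqF].
exact/derivable1_diffP/derivable_atan.
Qed.

Lemma angle_lift_param b : angle_lift x i p b ->
  {for a, continuous (b \o param i)} /\
  \forall c \near a, polar (f c) (g c) ((b \o param i) c).
Proof.
move=> bP.
have pc : {for a, continuous (param i)} by apply: param_continuous; exists p.
have pa : param i a = p by exact: chartK.
split.
  apply: continuous_comp => //.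
  by have [] := nbhs_singleton bP; rewrite pa.
have bP' : \forall c \near a, lagrangian_angle x i (param i c) (b (param i c)).
  apply: (pc (fun q => lagrangian_angle x i q (b q))).
  by rewrite pa; apply: filterS bP => q [].
apply: filterS2 bP' (chart_nbhs ip) => c bc [q iq qc].
by move: bc; rewrite -qc /= chartK// => /(polar_density x_imm iq).
Qed.

(** The lift selected in [angle_differential] is unspecified, but
[differentiable_angle] and [derive_angle] hold for every continuous lift. *)
Lemma angle_differential_density k :
  (f a ^+ 2 + g a ^+ 2) * angle_differential x i p 'e_k =
  f a * 'D_('e_k) g a - g a * 'D_('e_k) f a.
Proof.
have [bc bP] := angle_lift_param (xgetPex (cst 0 : M -> R) angle_lift_exists).
have fd := differentiable_Re_density x_imm ip.
have gd := differentiable_Im_density x_imm ip.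
rewrite /angle_differential /tdiff -deriveE; last first.
  exact: differentiable_angle fd gd bc bP fg0.
exact: derive_angle fd gd bc bP fg0 _.
Qed.

End LagrangianAngleDerivative.

(** * The gradient formula *)

Theorem theorem1p2 (R : realType) (M : oriented_surface R) (x : M -> C2 R)
    (x_imm : smooth_immersion x)
    (theta : R) (theta_const : is_kahler_angle x (cst theta))
    (i : atlas M) (p : M) (ip : dom i p) :
  sin theta ^+ 2 *: tdiff i p x (angle_gradient x i p) =
    - tangential x i p (J (mean_curvature x i p)).
Proof.
pose U := tdiff i p x 'e_0; pose V := tdiff i p x 'e_1; pose g := sq_area U V.
have inj := x_imm.2 i p ip.
have g_gt0 : 0 < g by exact: sq_area_gt0.
pose N := Omega U V.
have N2 : complex.Re N ^+ 2 + complex.Im N ^+ 2 = sin theta ^+ 2 * g.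
  exact: normsq_Omega_sin.
have key k : sin theta ^+ 2 * angle_differential x i p 'e_k =
    dot (mean_curvature x i p) (J (tdiff i p x 'e_k)).
  have H := mean_curvature_Omega x_imm theta_const ip k.
  apply: (mulfI (lt0r_neq0 g_gt0)); rewrite {}H -/U -/V -/N.
  (* In this case N = 0, so the tangential part of J H vanishes too. *)
  have [s0|s0] := eqVneq (sin theta) 0.
    move: N2; rewrite s0 expr0n !mul0r mulr0 => /eqP.
    rewrite /im_conj_mul paddr_eq0 ?sqr_ge0// !sqrf_eq0 => /andP[/eqP-> /eqP->].
    by rewrite !mul0r subrr.
  have fE : Re_density x i (chart i p) = complex.Re N.
    by rewrite /Re_density -!(tdiff_partial x_imm ip).
  have gE : Im_density x i (chart i p) = complex.Im N.
    by rewrite /Im_density -!(tdiff_partial x_imm ip).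
  have fg0 : 0 < Re_density x i (chart i p) ^+ 2 +
      Im_density x i (chart i p) ^+ 2.
    by rewrite fE gE N2 mulr_gt0// exprn_even_gt0.
  have D0 := is_derive_partial x_imm ip k 0.
  have D1 := is_derive_partial x_imm ip k 1.
  have [_ fD] := is_derive_bilinear (@Re_Omega_bilinear R) D0 D1.
  have [_ gD] := is_derive_bilinear (@Im_Omega_bilinear R) D0 D1.
  have := angle_differential_density x_imm ip fg0 k.
  rewrite fE gE N2 mulrA [g * _]mulrC => ->.
  rewrite /Re_density /Im_density fD gD -!(tdiff_partial x_imm ip) -/U -/V.
  rewrite /im_conj_mul.
  by case: (Omega (ambient_derivative _ _ _ _ _) _) (Omega U _) => [? ?] [? ?].
rewrite /angle_gradient /tangential /sharp.
set G := invmx _; set H := mean_curvature x i p.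
pose L := 'd (x \o param i) (chart i p).
rewrite -[tdiff i p x _]/(L _) -[X in _ = - X]/(L _) -linearZ -linearN.
(* Both sides are images of linear forms with raised index: compare the forms
   on the coordinate vectors. *)
congr (L _); rewrite scalemxAl -mulNmx; congr (_ *m _).
apply/rowP => k; rewrite !mxE key.
by rewrite [dot (J H) _]dotC !dotJ opprK [RHS]omega_anti.
Qed.
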